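(* The $R$-algebra $\mathcal H_{n,r}$ is isomorphic to the $R$-algebra with generators $g_1,\ldots,g_{n-1}$ and $b_{\mathbf k}$ for $\mathbf k\in[1,r]^n$, subject to the defining relations (1) $g_ig_j=g_jg_i$ for $|i-j|>1$; (2) $g_ig_{i+1}g_i=g_{i+1}g_ig_{i+1}$ for $1\le i\le n-2$; (3) $g_i^2=1+(q-q^{-1})e_ig_i$ for $1\le i\le n-1$, where $e_i:=\sum_{\mathbf k,\ k_i=k_{i+1}}b_{\mathbf k}$; (4) $b_{\mathbf k}b_{\mathbf k'}=\delta_{\mathbf k,\mathbf k'}b_{\mathbf k}$ for all $\mathbf k,\mathbf k'\in[1,r]^n$; (5) $g_ib_{\mathbf k}=b_{s_i.\mathbf k}g_i$ for $1\le i\le n-1$, $\mathbf k\in[1,r]^n$; (6) $\sum_{\mathbf k\in[1,r]^n}b_{\mathbf k}=1$. The isomorphism sends $g_i\mapsto T_i+B'_{i,i+1}$ and $b_{\mathbf k}\mapsto \prod_{i=1}^n\prod_{1\le j\le r,\,j\ne k_i}\frac{t_i-u_j}{u_{k_i}-u_j}$. (In particular, this presentation does not involve $u_1,\ldots,u_r$.)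
   Context: Standing setup: $R$ is an integral domain, $n\ge 1$, $r\ge 1$, and $q,u_1,\ldots,u_r\in R$ with $q$ invertible in $R$ and $\Delta:=\prod_{1\le j<i\le r}(u_i-u_j)$ invertible in $R$. For $1\le c\le r$ let $F_c(X)\in R[X]$ be the unique polynomial of degree $\le r-1$ with $F_c(u_{c'})=\delta_{c,c'}\Delta$ for all $1\le c'\le r$. The modified Ariki–Koike (Shoji) algebra $\mathcal H_{n,r}=\mathcal H_{n,r}(R,q,u_1,\ldots,u_r)$ is the associative $R$-algebra generated by $t_1,\ldots,t_n,T_1,\ldots,T_{n-1}$ subject to: $(T_i-q)(T_i+q^{-1})=0$; $(t_i-u_1)\cdots(t_i-u_r)=0$; $T_iT_{i+1}T_i=T_{i+1}T_iT_{i+1}$; $T_iT_j=T_jT_i$ for $|i-j|\ge2$; $t_it_j=t_jt_i$; $T_jt_k=t_kT_j$ for $k\ne j,j+1$; and for $2\le j\le n$: $T_{j-1}t_j=t_{j-1}T_{j-1}+\Delta^{-2}\sum_{1\le c_1<c_2\le r}(u_{c_2}-u_{c_1})(q-q^{-1})F_{c_1}(t_{j-1})F_{c_2}(t_j)$ and $T_{j-1}t_{j-1}=t_jT_{j-1}-\Delta^{-2}\sum_{1\le c_1<c_2\le r}(u_{c_2}-u_{c_1})(q-q^{-1})F_{c_1}(t_{j-1})F_{c_2}(t_j)$. Write $[1,r]=\{1,\ldots,r\}$; in $\mathcal H_{n,r}$, $B'_{i,j}:=-(q-q^{-1})\sum_{\mathbf k,\ k_i<k_j}\prod_{l=1}^n\prod_{m\ne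 k_l}\frac{t_l-u_m}{u_{k_l}-u_m}$. For $\mathbf k\in[1,r]^n$ and $1\le i\le n-1$, $s_i.\mathbf k$ denotes $\mathbf k$ with entries $i$ and $i+1$ swapped. *)

(* Defs.v *)
From HB Require Import structures.
From mathcomp Require Import all_boot all_order all_algebra.
Set Implicit Arguments. Unset Strict Implicit. Unset Printing Implicit Defensive.
Import Order.TTheory GRing.Theory Num.Theory.
Local Open Scope ring_scope.

(* Conventions: positions 1..n of the paper are 0..n-1 here,
   colours 1..r are the ordinals 'I_r, T_i / g_i of the paper (i=1..n-1)
   are T (i-1) / g (i-1), so that T j, g j act on positions j, j+1. *)

Section Defs.
Variables (R : idomainType) (n r : nat) (q : R) (u : 'I_r -> R).

Definition Delta : R := \prod_(i < r) \prod_(j < r | (j < i)%N) (u i - u j).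

Definition mindex := {ffun 'I_n -> 'I_r}.

Definition swapk (i : nat) (k : mindex) : mindex :=
  [ffun l : 'I_n => k (insubd l (if val l == i then i.+1
                                 else if val l == i.+1 then i else val l))].

Definition klt (k : mindex) (i j : nat) : bool :=
  [exists l : 'I_n, exists l' : 'I_n, [&& val l == i, val l' == j & (k l < k l')%N]].
Definition keq (k : mindex) (i j : nat) : bool :=
  [exists l : 'I_n, exists l' : 'I_n, [&& val l == i, val l' == j & k l == k l']].

Section InAlg.
Variable (S : algType R).

Definition bk (t : nat -> S) (k : mindex) : S :=
  \prod_(l < n) \prod_(m < r | m != k l) ((u (k l) - u m)^-1 *: (t l - (u m)%:A)).

Definition Bp (t : nat -> S) (i j : nat) : S :=
  - ((q - q^-1) *: \sum_(k : mindex | klt k i j) bk t k).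

(* Defining relations of H_{n,r}; F c is the polynomial F_c of the paper.
   t p = t_{p+1}, T j = T_{j+1}. *)
Definition shoji_rel (F : 'I_r -> {poly R}) (t T : nat -> S) : Prop :=
  (forall i, (i.+1 < n)%N -> (T i - q%:A) * (T i + q^-1%:A) = 0) /\
      (forall i, (i < n)%N -> \prod_(c < r) (t i - (u c)%:A) = 0) /\
      (forall i, (i.+2 < n)%N -> T i * T i.+1 * T i = T i.+1 * T i * T i.+1) /\
      (forall i j, (i.+1 < n)%N -> (j.+1 < n)%N -> (i.+1 < j)%N || (j.+1 < i)%N ->
          T i * T j = T j * T i) /\
      (forall i j, (i < n)%N -> (j < n)%N -> t i * t j = t j * t i) /\
      (forall j k, (j.+1 < n)%N -> (k < n)%N -> k != j -> k != j.+1 ->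
          T j * t k = t k * T j) /\
      (forall j, (j.+1 < n)%N ->
         let Z := \sum_(c1 < r) \sum_(c2 < r | (c1 < c2)%N)
                    ((Delta ^- 2 * (u c2 - u c1) * (q - q^-1)) *:
                       (horner_alg (t j) (F c1) * horner_alg (t j.+1) (F c2))) in
         T j * t j.+1 = t j * T j + Z /\ T j * t j = t j.+1 * T j - Z).

(* Defining relations (1)-(6) of the second presentation; g i = g_{i+1}. *)
Definition e_gen (b : mindex -> S) (i : nat) : S :=
  \sum_(k : mindex | keq k i i.+1) b k.

Definition gb_rel (g : nat -> S) (b : mindex -> S) : Prop :=
  (forall i j, (i.+1 < n)%N -> (j.+1 < n)%N -> (i.+1 < j)%N || (j.+1 < i)%N ->
          g i * g j = g j * g i) /\
      (forall i, (i.+2 < n)%N -> g i * g i.+1 * g i = g i.+1 * g i * g i.+1) /\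
      (forall i, (i.+1 < n)%N -> g i ^+ 2 = 1 + (q - q^-1) *: (e_gen b i * g i)) /\
      (forall k k', b k * b k' = if k == k' then b k else 0) /\
      (forall i k, (i.+1 < n)%N -> g i * b k = b (swapk i k) * g i) /\
      \sum_(k : mindex) b k = 1.
End InAlg.

(* H (with t, T) is the R-algebra presented by the Shoji relations:
   universal property of the presentation. *)
Definition is_shoji_algebra (F : 'I_r -> {poly R}) (H : algType R) (t T : nat -> H) : Prop :=
  [/\ shoji_rel F t T,
      (forall (S : algType R) (t' T' : nat -> S), shoji_rel F t' T' ->
         exists f : {lrmorphism H -> S},
           (forall i, (i < n)%N -> f (t i) = t' i) /\
           (forall i, (i.+1 < n)%N -> f (T i) = T' i)) &
      (forall (S : algType R) (f f' : {lrmorphism H -> S}),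
         (forall i, (i < n)%N -> f (t i) = f' (t i)) ->
         (forall i, (i.+1 < n)%N -> f (T i) = f' (T i)) -> f =1 f')].

Definition is_gb_algebra (A : algType R) (g : nat -> A) (b : mindex -> A) : Prop :=
  [/\ gb_rel g b,
      (forall (S : algType R) (g' : nat -> S) (b' : mindex -> S), gb_rel g' b' ->
         exists f : {lrmorphism A -> S},
           (forall i, (i.+1 < n)%N -> f (g i) = g' i) /\
           (forall k, f (b k) = b' k)) &
      (forall (S : algType R) (f f' : {lrmorphism A -> S}),
         (forall i, (i.+1 < n)%N -> f (g i) = f' (g i)) ->
         (forall k, f (b k) = f' (b k)) -> f =1 f')].
End Defs.

(* Main.v *)
Require Import Defs.
From HB Require Import structures.
From mathcomp Require Import all_boot all_order all_algebra all_fingroup.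
From mathcomp Require Import zify ring.
Import GRing.Theory.
Local Open Scope ring_scope.

(** Call [x] of weight [k] when [b_k x = x].  Both presentations contain a
    complete system of orthogonal idempotents [b_k] on whose weight spaces [t_l]
    acts by the scalar [u_(k_l)]: in [H] they come from Lagrange interpolation,
    since polynomials agreeing at all [u_c] agree at [t_l]; conversely
    [t_l = sum_k u_(k_l) b_k].  The generators are related by
    [T_i = g_i + (q - q^-1) sum_(k_i < k_(i+1)) b_k], so [T_i] differs from [g_i]
    on a weight vector by a scalar depending only on the order of [k_i] and
    [k_(i+1)], and [g_i] maps weight [k] to weight [s_i k].  Evaluating on weight
    vectors shows that the quadratic, braid and commutation defects of the [T_i]
    equal those of the [g_i], and that the relations between [T_i] and [t_j] say
    exactly that [g_i] intertwines the [t_j]; since the [u_c] differ by units,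
    this amounts to [g_i b_k = b_(s_i k) g_i]. *)

(** * Swapped colour vectors and comparison of their entries *)

Section Colours.
Set Implicit Arguments. Unset Strict Implicit.
Variables (n r : nat).
Implicit Types k : mindex n r.

(** With both positions in range the default of [insubd] is never reached, so the swap is
    precomposition with a transposition. *)
Lemma swapk_tperm i k (l l' j : 'I_n) : l = i :> nat -> l' = i.+1 :> nat ->
  swapk i k j = k (tperm l l' j).
Proof.
move=> li l'i; rewrite /swapk ffunE; congr (k _); apply: val_inj => /=.
case: tpermP => [->|->|/eqP jl /eqP jl'].
- by rewrite li eqxx -l'i val_insubd ltn_ord.
- by rewrite l'i gtn_eqF // eqxx -li val_insubd ltn_ord.
- rewrite -l'i -li; move: jl jl'; rewrite -!val_eqE /= => /negPf-> /negPf->.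
  by rewrite val_insubd ltn_ord.
Qed.

Lemma kltE k (l l' : 'I_n) : klt k l l' = (k l < k l')%N.
Proof.
apply/existsP/idP => [[a /existsP[b /and3P[/eqP/val_inj-> /eqP/val_inj->]]]|kl] //.
by exists l; apply/existsP; exists l'; rewrite !eqxx.
Qed.

Lemma keqE k (l l' : 'I_n) : keq k l l' = (k l == k l').
Proof.
apply/existsP/idP => [[a /existsP[b /and3P[/eqP/val_inj-> /eqP/val_inj->]]]|kl] //.
by exists l; apply/existsP; exists l'; rewrite !eqxx.
Qed.

End Colours.

(** * Calculus on the weight spaces of a complete orthogonal system *)

Section Weights.
Set Implicit Arguments. Unset Strict Implicit.
Variables (R : idomainType) (S : algType R) (n r : nat) (b : mindex n r -> S).
Hypothesis bM : forall k k', b k * b k' = if k == k' then b k else 0.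
Hypothesis b1 : \sum_k b k = 1.
Implicit Types (x y : S) (k : mindex n r).

Lemma weight_ext x y : (forall k, x * b k = y * b k) -> x = y.
Proof.
by move=> xy; rewrite -[x]mulr1 -[y]mulr1 -b1 !mulr_sumr; apply: eq_bigr => k _.
Qed.

Lemma sum_weight (P : pred (mindex n r)) k x : b k * x = x ->
  (\sum_(k' | P k') b k') * x = (P k)%:R *: x.
Proof.
move=> xk; rewrite -xk mulrA mulr_suml (eq_bigr _ (fun i _ => bM i k)).
rewrite big_mkcond (bigD1 k) //= eqxx big1 ?addr0 => [|k' /negPf->]; last by rewrite if_same.
by case: (P k); rewrite ?scale1r ?scale0r ?mul0r.
Qed.

Lemma scaled_sum_weight (c : mindex n r -> R) k x : b k * x = x ->
  (\sum_k' c k' *: b k') * x = c k *: x.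
Proof.
move=> xk; rewrite -xk mulrA mulr_suml (bigD1 k) //= big1 => [|k' /negPf k'k].
  by rewrite addr0 -scalerAl bM eqxx -scalerAl.
by rewrite -scalerAl bM k'k scaler0.
Qed.

Lemma weight_idem k : b k * b k = b k. Proof. by rewrite bM eqxx. Qed.

(** * Passing from [g] to the shifted generators [T] *)

Section Shift.
Variables (Q : R) (g T : nat -> S).
Hypothesis gb : forall i k, (i.+1 < n)%N -> g i * b k = b (swapk i k) * g i.
Hypothesis TE : forall i, (i.+1 < n)%N ->
  T i = g i + Q *: \sum_(k : mindex n r | klt k i i.+1) b k.

Lemma swap_weight i k x : (i.+1 < n)%N -> b k * x = x ->
  b (swapk i k) * (g i * x) = g i * x.
Proof. by move=> ltin xk; rewrite mulrA -gb // -mulrA xk. Qed.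

Lemma shift_weight (l l' : 'I_n) k x : l' = l.+1 :> nat -> b k * x = x ->
  T l * x = g l * x + (Q * (k l < k l')%:R) *: x.
Proof.
move=> l'l xk; have ltl : (l.+1 < n)%N by rewrite -l'l.
by rewrite TE // mulrDl -scalerAl (sum_weight _ xk) scalerA -l'l kltE.
Qed.

Lemma e_gen_weight (l l' : 'I_n) k x : l' = l.+1 :> nat -> b k * x = x ->
  e_gen b l * x = (k l == k l')%:R *: x.
Proof. by move=> l'l xk; rewrite (sum_weight _ xk) -l'l keqE. Qed.

(** On weight [k] the two shifts add to the coefficient of [g i] the indicators of [k l < k l'] and
    [k l' < k l], times [Q]. By trichotomy, subtracting [Q] leaves minus the indicator of equality,
    which is the action of [e_gen]; the terms in [Q ^+ 2] cancel. *)
Lemma shift_quadratic i : (i.+1 < n)%N ->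
  T i ^+ 2 - (1 + Q *: T i) = g i ^+ 2 - (1 + Q *: (e_gen b i * g i)).
Proof.
move=> ltin; pose l := Ordinal (ltnW ltin); pose l' := Ordinal ltin.
apply: weight_ext => k.
have xk := weight_idem k; have gk := @swap_weight i _ _ ltin xk.
rewrite !mulrBl !expr2 !mulrDl !mul1r -!mulrA -!scalerAl -!mulrA.
rewrite (@shift_weight l l' _ _ erefl xk) mulrDr -scalerAr.
rewrite (@shift_weight l l' _ _ erefl xk) (@shift_weight l l' _ _ erefl gk).
rewrite (@e_gen_weight l l' _ _ erefl gk).
rewrite !(@swapk_tperm _ _ i _ l l') // tpermL tpermR /=.
rewrite [X in _ = X - _]/=; set y := g i * (g i * _); set z := g i * _; set x := b k.
rewrite -!addrA; congr (y + _); rewrite !scalerDr !opprD !scalerA !addrA.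
rewrite -[k l' == k l]val_eqE /=.
case: ltngtP => _; rewrite ?(mulr0, mulr1, scale0r, addr0, add0r, oppr0, subr0) //.
- by rewrite addrAC subrr add0r.
- by rewrite [LHS](ACl ((1*4)*(2*5)*3))%AC /= !subrr !add0r.
Qed.

(** Both words are expanded on a weight vector while tracking the moving colours. Repeated factors
    such as [g l0 * g l0] arise and are reduced by the quadratic relation. *)
Lemma shift_braid (l0 l1 l2 : 'I_n) : l1 = l0.+1 :> nat -> l2 = l1.+1 :> nat ->
  (forall i, (i.+1 < n)%N -> g i ^+ 2 = 1 + Q *: (e_gen b i * g i)) ->
  T l0 * T l1 * T l0 - T l1 * T l0 * T l1 = g l0 * g l1 * g l0 - g l1 * g l0 * g l1.
Proof.
move=> l10 l21 gq; apply: weight_ext => k.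
have lt0 : (l0.+1 < n)%N by rewrite -l10.
have lt1 : (l1.+1 < n)%N by rewrite -l21.
have l0N1 : (l0 == l1) = false by rewrite -val_eqE /= l10 ltn_eqF.
have l0N2 : (l0 == l2) = false by rewrite -val_eqE /= l21 l10 ltn_eqF // -addn2 leq_addr.
have l1N2 : (l1 == l2) = false by rewrite -val_eqE /= l21 ltn_eqF.
(* The quadratic relation read on a weight vector; equality of the two colours survives the swap. *)
have gg (l l' : 'I_n) k' x : l' = l.+1 :> nat -> b k' * x = x ->
    g l * (g l * x) = x + (Q * (k' l == k' l')%:R) *: (g l * x).
  move=> l'l xk; have ltl : (l.+1 < n)%N by rewrite -l'l.
  rewrite mulrA -expr2 gq // mulrDl mul1r -scalerAl -mulrA.
  rewrite (e_gen_weight l'l (swap_weight ltl xk)) scalerA.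
  by rewrite !(@swapk_tperm _ _ _ _ l l') // tpermL tpermR eq_sym.
have s0 k' j : swapk l0 k' j = k' (tperm l0 l1 j) by apply: swapk_tperm.
have s1 k' j : swapk l1 k' j = k' (tperm l1 l2 j) by apply: swapk_tperm.
have xk := weight_idem k.
have x0 := swap_weight lt0 xk; have x1 := swap_weight lt1 xk.
have x10 := swap_weight lt1 x0; have x01 := swap_weight lt0 x1.
have tE : (tperm l0 l1 l2 = l2) * (tperm l1 l2 l0 = l0).
  by split; rewrite tpermD // eq_sym ?l0N1 ?l0N2 ?l1N2 // eq_sym ?l0N1 ?l0N2 ?l1N2.
rewrite !mulrBl -!mulrA.
rewrite (shift_weight l10 xk) (shift_weight l21 xk).
rewrite !mulrDr -!scalerAr.
rewrite (shift_weight l10 xk) (shift_weight l21 xk).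
rewrite (shift_weight l21 x0) (shift_weight l10 x1).
rewrite !mulrDr -!scalerAr.
rewrite (shift_weight l10 xk) (shift_weight l21 xk).
rewrite (shift_weight l10 x0) (shift_weight l21 x1).
rewrite (shift_weight l10 x10) (shift_weight l21 x01).
rewrite (shift_weight l10 x1) (shift_weight l21 x0).
rewrite (gg _ _ _ _ l10 xk) (gg _ _ _ _ l21 xk).
rewrite !(s0, s1, tpermL, tpermR, tE).
set u0 := g l0 * (_ * (_ * _)); set u1 := g l1 * (_ * (_ * _)).
set u10 := g l1 * (_ * _); set u01 := g l0 * (_ * _).
set v0 := g l0 * _; set v1 := g l1 * _; set x := b k.
rewrite -!val_eqE /=.
(* Both braid words expand to the same combination of u10, u01, v0, v1, x;
   this only depends on the relative order of the three colours. *)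
apply/eqP; rewrite subr_eq [X in _ == X]addrAC eq_sym subr_eq; apply/eqP.
clearbody u0 u1 u10 u01 v0 v1 x.
move: (nat_of_ord (k l0)) (nat_of_ord (k l1)) (nat_of_ord (k l2)) => a d c.
have zE := (mulr0, mulr1, scale0r, scaler0, addr0, add0r, scalerDr, scalerA, addrA).
have [ad|da|->] := ltngtP a d; have [dc|cd|dc] := ltngtP d c; try subst c.
all: try rewrite (ltn_trans ad dc); try rewrite ad; try rewrite [(a < d)%N]ltnNge (ltnW da);
  try rewrite [(a < c)%N]ltnNge (ltnW (ltn_trans cd da)); rewrite ?ltnn.
all: try case: (a < c)%N; rewrite /= ?zE //.
all: first [ by rewrite [LHS](ACl (1 * 3 * 2))%AC
           | by rewrite [LHS](ACl (1 * 4 * 3 * 5 * 2))%AC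
           | by rewrite [LHS](ACl (1 * 5 * 4 * 3 * 7 * 6 * 8 * 2))%AC].
Qed.

(** The swaps move disjoint pairs of positions, so neither changes the scalar added by the other and
    the mixed terms cancel. *)
Lemma shift_far (l0 l1 l2 l3 : 'I_n) : l1 = l0.+1 :> nat -> l3 = l2.+1 :> nat ->
  (l1 < l2)%N || (l3 < l0)%N ->
  T l0 * T l2 - T l2 * T l0 = g l0 * g l2 - g l2 * g l0.
Proof.
move=> l10 l32 far; apply: weight_ext => k.
have lt0 : (l0.+1 < n)%N by rewrite -l10.
have lt2 : (l2.+1 < n)%N by rewrite -l32.
have [l02 l03 l12 l13] : [/\ l0 != l2, l0 != l3, l1 != l2 & l1 != l3].
  by split; apply/eqP => /(congr1 (@nat_of_ord n)); lia.
have xk := weight_idem k.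
have x0 := swap_weight lt0 xk; have x2 := swap_weight lt2 xk.
rewrite !mulrBl -!mulrA (shift_weight l10 xk) (shift_weight l32 xk).
rewrite !mulrDr -!scalerAr.
rewrite (shift_weight l10 xk) (shift_weight l32 xk).
rewrite (shift_weight l10 x2) (shift_weight l32 x0).
rewrite !(swapk_tperm _ _ erefl l32) !(swapk_tperm _ _ erefl l10).
rewrite !tpermD // 1?eq_sym //.
set al := Q * _; set be := Q * _.
apply/eqP; rewrite subr_eq [X in _ == X]addrAC eq_sym subr_eq eq_sym; apply/eqP.
rewrite !scalerDr !scalerA [be * al]mulrC !addrA.
by rewrite [LHS](ACl (1 * 5 * 3 * 2 * 4))%AC.
Qed.

End Shift.

(** * Elements [t l] acting diagonally by the colours *)

Section JucysMurphy.
Variables (u : 'I_r -> R) (t : nat -> S).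
Hypothesis tb : forall (l : 'I_n) k, t l * b k = u (k l) *: b k.

Lemma horner_weight p (l : 'I_n) k : horner_alg (t l) p * b k = p.[u (k l)] *: b k.
Proof.
elim/poly_ind: p => [|p c IHp]; first by rewrite rmorph0 mul0r horner0 scale0r.
rewrite rmorphD rmorphM /= horner_algX horner_algC hornerMXaddC mulrDl -mulrA tb.
by rewrite -scalerAr IHp scalerA -scalerAl mul1r scalerDl mulrC.
Qed.

(** On weight [k], [F c] evaluated at [t l] acts as [Delta u] if [c = k l] and as 0 otherwise. Only
    [c1 = k l], [c2 = k l'] survives, and [Delta u ^- 2] cancels the two values. *)
Lemma interaction_weight (F : 'I_r -> {poly R}) (Q : R) (l l' : 'I_n) k :
  Delta u \is a GRing.unit ->
  (forall c c', (F c).[u c'] = (if c == c' then Delta u else 0)) ->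
  (\sum_(c1 < r) \sum_(c2 < r | (c1 < c2)%N)
     ((Delta u ^- 2 * (u c2 - u c1) * Q) *:
        (horner_alg (t l) (F c1) * horner_alg (t l') (F c2)))) * b k
  = (Q * (k l < k l')%:R * (u (k l') - u (k l))) *: b k.
Proof.
move=> uD FE; rewrite mulr_suml (bigD1 (k l)) //= [X in _ + X]big1 => [|c1 /negPf c1k].
  rewrite addr0 mulr_suml big_mkcond (bigD1 (k l')) //= big1 => [|c2 /negPf c2k].
    rewrite addr0; case: ifP => _; last by rewrite mulr0 mul0r scale0r.
    rewrite -scalerAl -[_ * b k]mulrA !horner_weight -scalerAr horner_weight !scalerA !FE !eqxx.
    congr (_ *: _); rewrite mulr1 -[RHS]mul1r -(mulVr (unitrX 2 uD)) expr2; ring.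
  by case: ifP => // _; rewrite -scalerAl -[_ * b k]mulrA horner_weight FE c2k
    scale0r mulr0 scaler0.
rewrite mulr_suml big1 // => c2 _.
rewrite -scalerAl -[_ * b k]mulrA horner_weight -scalerAr horner_weight !FE c1k.
by rewrite scale0r !scaler0.
Qed.

Lemma tM_comm (l l' : 'I_n) : t l * t l' = t l' * t l.
Proof.
by apply: weight_ext => k; rewrite -!mulrA !tb -!scalerAr !tb !scalerA mulrC.
Qed.

Lemma t_colours (l : 'I_n) : \prod_(c < r) (t l - (u c)%:A) = 0.
Proof.
have -> : \prod_(c < r) (t l - (u c)%:A) = horner_alg (t l) (\prod_(c < r) ('X - (u c)%:P)).
  by rewrite rmorph_prod; apply: eq_bigr => c _; rewrite rmorphB /= horner_algX horner_algC.
apply: weight_ext => k; rewrite horner_weight mul0r horner_prod (bigD1 (k l)) //=.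
by rewrite hornerXsubC subrr mul0r scale0r.
Qed.

Lemma bt (l : 'I_n) k : b k * t l = u (k l) *: b k.
Proof.
apply: weight_ext => k'; rewrite -mulrA tb -scalerAr -scalerAl bM.
by case: eqP => [->|_]; rewrite ?scaler0.
Qed.

(** Sandwiching the relation between [b k2] and [b k1] multiplies [b k2 * g * b k1] by a difference
    of colours, a unit as soon as [k2] is not [swapk l k1] and [j] is well chosen. So [g] has no
    other blocks. *)
Lemma weight_intertwine g (l l' : 'I_n) k : l' = l.+1 :> nat ->
  (forall c c', c != c' -> u c - u c' \is a GRing.unit) ->
  (forall j : 'I_n, g * t j = t (tperm l l' j) * g) ->
  g * b k = b (swapk l k) * g.
Proof.
move=> l'l uU gt.
have gb0 k1 k2 : k2 != swapk l k1 -> b k2 * g * b k1 = 0.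
  move=> nk; have [j nj] : exists j, k2 (tperm l l' j) != k1 j.
    apply/existsP; apply: contraNT nk => /existsPn nk; apply/eqP/ffunP => j.
    rewrite (swapk_tperm _ _ erefl l'l).
    by have := nk (tperm l l' j); rewrite negbK tpermK => /eqP.
  have : b k2 * (t (tperm l l' j) * g - g * t j) * b k1 = 0.
    by rewrite gt subrr mulr0 mul0r.
  rewrite mulrBr mulrBl !mulrA bt -!mulrA tb -!scalerAl -!scalerAr -scalerBl.
  move/(congr1 ( *:%R (u (k2 (tperm l l' j)) - u (k1 j))^-1)).
  by rewrite scaler0 scalerA mulVr ?uU // scale1r mulrA.
transitivity (b (swapk l k) * g * b k).
  rewrite -[LHS]mul1r -b1 mulr_suml (bigD1 (swapk l k)) //= big1 ?addr0 ?mulrA // => k' nk.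
  by rewrite mulrA gb0.
rewrite -[RHS]mulr1 -b1 mulr_sumr (bigD1 k) //= big1 ?addr0 // => k' nk.
(* [swapk l] is injective, so no other weight is sent to [swapk l k]. *)
apply: gb0; apply: contraNneq nk => /(congr1 (@swapk n r l)) sk; apply/eqP/ffunP => j.
move/ffunP/(_ j): sk; rewrite !(swapk_tperm _ _ erefl l'l).
by rewrite tpermK.
Qed.

Lemma intertwine_t (gi : S) (l l' j : 'I_n) : l' = l.+1 :> nat ->
  (forall k, gi * b k = b (swapk l k) * gi) -> gi * t j = t (tperm l l' j) * gi.
Proof.
move=> l'l gib; apply: weight_ext => k.
rewrite -!mulrA gib tb -scalerAr gib mulrA tb (swapk_tperm _ _ erefl l'l).
by rewrite tpermK scalerAl.
Qed.

End JucysMurphy.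
End Weights.

Lemma annihil_prod (S : pzRingType) (I : eqType) (s : seq I) (F : I -> S) (x : S) i0 :
  (forall i, GRing.comm x (F i)) -> i0 \in s -> x * F i0 = 0 ->
  x * \prod_(i <- s) F i = 0.
Proof.
move=> xF; elim: s => // i s IHs; rewrite inE big_cons => /predU1P[-> xi0|si xi0].
  by rewrite mulrA xi0 mul0r.
by rewrite mulrA xF -mulrA IHs ?mulr0.
Qed.

(** * Lagrange interpolation at the colours *)

Section Lagrange.
Set Implicit Arguments. Unset Strict Implicit.
Variables (R : idomainType) (S : algType R) (r : nat) (u : 'I_r -> R).
Hypothesis uU : forall c c', c != c' -> u c - u c' \is a GRing.unit.

(** The difference has every [u c] as a root. As differences of colours are units, the product of
    all ['X - (u c)%:P] divides it, and that product vanishes at [a]. *)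
Lemma horner_alg_eq_values (a : S) p p' : \prod_(c < r) (a - (u c)%:A) = 0 ->
  (forall c, p.[u c] = p'.[u c]) -> horner_alg a p = horner_alg a p'.
Proof.
move=> a0 pp'; apply/eqP; rewrite -subr_eq0 -rmorphB /=.
have /uniq_roots_prod_XsubC[|d ->] : all (root (p - p')) [seq u c | c : 'I_r].
- by apply/allP => _ /mapP[c _ ->]; rewrite /root hornerD hornerN pp' subrr.
- rewrite /image_mem; elim: (enum _) (enum_uniq 'I_r) => //= c s IHs /andP[cs us].
  rewrite IHs // andbT; apply/allP => _ /mapP[c' c's ->].
  rewrite /diff_roots mulrC eqxx /= uU //; by apply: contraNneq cs => <-.
rewrite big_image rmorphM rmorph_prod /=.
rewrite (eq_bigr (fun c => a - (u c)%:A)) ?a0 ?mulr0 // => c _.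
by rewrite rmorphB /= horner_algX horner_algC.
Qed.

Definition lagrange (c : 'I_r) : {poly R} :=
  \prod_(m < r | m != c) ((u c - u m)^-1 *: ('X - (u m)%:P)).

Lemma lagrange_value c c' : (lagrange c).[u c'] = (c == c')%:R.
Proof.
rewrite horner_prod; have [<-|/eqP cc'] := c =P c'.
  by apply: big1 => m mc; rewrite hornerZ hornerXsubC mulVr // uU // eq_sym.
by rewrite (bigD1 c') 1?eq_sym //= hornerZ hornerXsubC subrr mulr0 mul0r.
Qed.

(** * The idempotents built from commuting [t l] *)

Section ColourIdempotents.
Variables (n : nat) (t : nat -> S).
Hypothesis tC : forall l l' : 'I_n, t l * t l' = t l' * t l.
Hypothesis t0 : forall l : 'I_n, \prod_(c < r) (t l - (u c)%:A) = 0.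
Implicit Type k : mindex n r.

Lemma bk_lagrange k : bk u t k = \prod_(l < n) horner_alg (t l) (lagrange (k l)).
Proof.
apply: eq_bigr => l _; rewrite rmorph_prod; apply: eq_bigr => m _ /=.
by rewrite -mul_polyC rmorphM rmorphB /= horner_algX !horner_algC mulr_algl.
Qed.

(** This is the expanded product over [l] of the sums of all Lagrange polynomials at [t l]; each
    such sum takes the value 1 at every colour. *)
Lemma bk_sum : \sum_(k : mindex n r) bk u t k = 1.
Proof.
under eq_bigr do rewrite bk_lagrange.
rewrite -(bigA_distr_bigA (fun (l : 'I_n) c => horner_alg (t l) (lagrange c))) /=.
apply: big1 => l _; rewrite -rmorph_sum /= -(rmorph1 (horner_alg (t l))).
apply: horner_alg_eq_values => // c; rewrite horner_sum hornerC (bigD1 c) //=.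
by rewrite lagrange_value eqxx big1 ?addr0 // => c' /negPf cc'; rewrite lagrange_value cc'.
Qed.

Lemma t_horner_comm (l l' : 'I_n) p : GRing.comm (t l) (horner_alg (t l') p).
Proof.
rewrite /GRing.comm; elim/poly_ind: p => [|p c IHp]; first by rewrite rmorph0 mul0r mulr0.
rewrite rmorphD rmorphM /= horner_algX horner_algC mulrDr mulrDl mulrA IHp.
by rewrite -!mulrA tC mulr_algr mulr_algl.
Qed.

Lemma t_bk (l : 'I_n) k : t l * bk u t k = u (k l) *: bk u t k.
Proof.
apply/eqP; rewrite -subr_eq0 -mulr_algl -mulrBl bk_lagrange; apply/eqP.
apply: (@annihil_prod _ _ _ _ _ l) => [l'||].
- by apply: commr_sym; apply: commrB;
    [apply/commr_sym/t_horner_comm | rewrite /GRing.comm mulr_algl mulr_algr].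
- by rewrite mem_index_enum.
(* The factor is the value at [t l] of ['X - (u (k l))%:P] times the Lagrange polynomial of [k l],
   which vanishes at every colour. *)
rewrite -{1}(horner_algX (t l)) -(horner_algC (t l)) -rmorphB -rmorphM /=.
rewrite -(rmorph0 (horner_alg (t l))); apply: horner_alg_eq_values => // c.
rewrite hornerM hornerXsubC lagrange_value horner0.
by case: eqP => [->|_]; rewrite ?subrr ?mulr0 ?mul0r.
Qed.

(** Distinct indices have eigenvalues differing by a unit for some [t l], whence orthogonality;
    multiplying [bk_sum] by one idempotent then gives idempotence. *)
Lemma bk_mul k k' : bk u t k * bk u t k' = if k == k' then bk u t k else 0.
Proof.
have bk0 k1 k2 : k1 != k2 -> bk u t k1 * bk u t k2 = 0.
  move=> nk; have [l nl] : exists l, k1 l != k2 l.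
    apply/existsP; apply: contraNT nk => /existsPn nk; apply/eqP/ffunP => l.
    by have := nk l; rewrite negbK => /eqP.
  have tb : t l * bk u t k1 = bk u t k1 * t l.
    by rewrite bk_lagrange; apply: commr_prod => l' _; apply: t_horner_comm.
  have /eqP : t l * bk u t k1 * bk u t k2 = bk u t k1 * (t l * bk u t k2).
    by rewrite mulrA tb.
  rewrite !t_bk -scalerAl -scalerAr -subr_eq0 -scalerBl => /eqP.
  move/(congr1 ( *:%R (u (k1 l) - u (k2 l))^-1)).
  by rewrite scaler0 scalerA mulVr ?uU // scale1r.
case: eqP => [<-|/eqP/bk0//].
rewrite -[RHS]mulr1 -bk_sum mulr_sumr (bigD1 k) //= big1 ?addr0 // => k1.
by rewrite eq_sym => /bk0.
Qed.

End ColourIdempotents.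
End Lagrange.

(** * Translating each set of relations into the other *)

Section Presentations.
Set Implicit Arguments. Unset Strict Implicit.
Variables (R : idomainType) (n r : nat) (q : R) (u : 'I_r -> R) (F : 'I_r -> {poly R}).
Hypothesis qU : q \is a GRing.unit.
Hypothesis uD : Delta u \is a GRing.unit.
Hypothesis FE : forall c c', (F c).[u c'] = (if c == c' then Delta u else 0).

Lemma Delta_unit_sub c c' : c != c' -> u c - u c' \is a GRing.unit.
Proof.
have lt_unit (i j : 'I_r) : (j < i)%N -> u i - u j \is a GRing.unit.
  move=> ji; move: uD; rewrite /Delta (bigD1 i) //= unitrM => /andP[+ _].
  by rewrite (bigD1 j) //= unitrM => /andP[].
by rewrite -val_eqE /= neq_ltn => /orP[/lt_unit|/lt_unit//]; rewrite -opprB unitrN.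
Qed.

Lemma hecke_quadratic (S : algType R) (x : S) :
  (x - q%:A) * (x + q^-1%:A) = x ^+ 2 - (1 + (q - q^-1) *: x).
Proof.
rewrite mulrDr !mulrBl mulr_algl !mulr_algr scalerA mulVr // scale1r expr2.
by rewrite scalerBl !opprD opprK !addrA [RHS](ACl (1 * 3 * 4 * 2))%AC.
Qed.

(** Stated for any [t] with the right eigenvalues, so that it applies to the one rebuilt from the
    idempotents. *)
Lemma shoji_of_gb (S : algType R) (t T g : nat -> S) (b : mindex n r -> S) :
  gb_rel q g b -> (forall (l : 'I_n) k, t l * b k = u (k l) *: b k) ->
  (forall i, (i.+1 < n)%N ->
     T i = g i + (q - q^-1) *: \sum_(k : mindex n r | klt k i i.+1) b k) ->
  shoji_rel n q u F t T.
Proof.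
case=> gfar [gbraid [gquad [bM [gb b1]]]] tb TE.
refine (conj _ (conj _ (conj _ (conj _ (conj _ (conj _ _)))))).
- move=> i ltin; rewrite hecke_quadratic (shift_quadratic bM b1 gb TE ltin).
  by rewrite gquad // subrr.
- by move=> i ltin; apply: (t_colours b1 tb (Ordinal ltin)).
- move=> i lti; apply/eqP; rewrite -subr_eq0.
  pose l2 := Ordinal lti; pose l1 := Ordinal (ltnW lti : (i.+1 < n)%N).
  pose l0 := Ordinal (ltnW (ltnW lti)).
  rewrite (@shift_braid _ _ _ _ _ bM b1 _ _ _ gb TE l0 l1 l2) //=.
  by rewrite gbraid // subrr.
- move=> i j lti ltj far; apply/eqP; rewrite -subr_eq0.
  rewrite (@shift_far _ _ _ _ _ bM b1 _ _ _ gb TE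
            (Ordinal (ltnW lti)) (Ordinal lti) (Ordinal (ltnW ltj)) (Ordinal ltj)) //=.
  by rewrite gfar // subrr.
- by move=> i j lti ltj; apply: (tM_comm b1 tb (Ordinal lti) (Ordinal ltj)).
- move=> j k ltj ltk kj kj1.
  pose l := Ordinal (ltnW ltj); pose l' := Ordinal ltj; pose m := Ordinal ltk.
  have gt := intertwine_t b1 tb m (erefl : l' = l.+1 :> nat) (fun k => gb l k ltj).
  (* The transposition fixes [m], so [g j] commutes with [t m]. *)
  rewrite tpermD 1?eq_sym // in gt.
  apply: (weight_ext b1) => c; have xc := weight_idem bM c.
  rewrite -!mulrA (tb m) -scalerAr (shift_weight bM TE (l := l) (l' := l') erefl xc).
  by rewrite mulrDr mulrA -gt -mulrA (tb m) -!scalerAr (tb m) scalerDr !scalerA mulrC.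
- move=> j ltj Z; pose l := Ordinal (ltnW ltj); pose l' := Ordinal ltj.
  have gt m := intertwine_t b1 tb m (erefl : l' = l.+1 :> nat) (fun k => gb l k ltj).
  (* The shift in [T j] is scaled by [u (c l')] on one side of a relation and by [u (c l)] on the
     other; [Z] supplies the difference. *)
  have Zk c : Z * b c = ((q - q^-1) * (c l < c l')%:R * (u (c l') - u (c l))) *: b c.
    exact: (interaction_weight tb (q - q^-1) l l' c uD FE).
  split; apply: (weight_ext b1) => c; have xc := weight_idem bM c.
    have := gt l'; rewrite tpermR mulrDl Zk -!mulrA => {}gt.
    rewrite (tb l') -scalerAr (shift_weight bM TE (l := l) (l' := l') erefl xc).
    rewrite mulrDr mulrA -gt -mulrA (tb l') -!scalerAr (tb l) scalerDr -addrA.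
    congr (_ + _).
    by rewrite !scalerA -scalerDl; congr (_ *: _); ring.
  have := gt l; rewrite tpermL mulrBl Zk -!mulrA => {}gt.
  rewrite (tb l) -scalerAr (shift_weight bM TE (l := l) (l' := l') erefl xc).
  rewrite mulrDr [t j.+1 * (_ * _)]mulrA -gt -mulrA (tb l) -!scalerAr (tb l') scalerDr -addrA.
  congr (_ + _).
  by rewrite !scalerA -scalerBl; congr (_ *: _); ring.
Qed.

Lemma gb_of_shoji (S : algType R) (t T : nat -> S) : shoji_rel n q u F t T ->
  gb_rel q (fun i => T i + Bp n q u t i i.+1) (@bk R n r u S t).
Proof.
case=> Tquad [tcol [Tbraid [Tfar [tC [Tt Ttt]]]]].
have uU := Delta_unit_sub.
have tC' (l l' : 'I_n) : t l * t l' = t l' * t l by apply: tC.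
have t0 (l : 'I_n) := tcol l (ltn_ord l).
set b := @bk R n r u S t; set g := fun i => _.
have bM : forall k k', b k * b k' = if k == k' then b k else 0 by apply: bk_mul.
have b1 : \sum_k b k = 1 by apply: bk_sum.
have tb (l : 'I_n) k : t l * b k = u (k l) *: b k by apply: t_bk.
have TE i : (i.+1 < n)%N ->
    T i = g i + (q - q^-1) *: \sum_(k : mindex n r | klt k i i.+1) b k.
  by rewrite /g /Bp addrNK.
have gE (l l' : 'I_n) k : l' = l.+1 :> nat ->
    g l * b k = T l * b k - ((q - q^-1) * (k l < k l')%:R) *: b k.
  by move=> l'l; rewrite (shift_weight bM TE l'l (weight_idem bM k)) addrK.
(* On each weight, removing the shift from [T l] absorbs the interaction term, leaving a pure
   intertwining relation. *)
have gt (l l' j : 'I_n) : l' = l.+1 :> nat -> g l * t j = t (tperm l l' j) * g l.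
  move=> l'l; have ltl : (l.+1 < n)%N by rewrite -l'l.
  apply: (weight_ext b1) => k.
  have := interaction_weight tb (q - q^-1) l l' k uD FE.
  have [] := Ttt l ltl; rewrite -l'l; set Z := \sum_(c1 < r) _ => Tl' Tl Zk.
  rewrite -!mulrA tb -scalerAr (gE _ _ _ l'l) mulrBr -scalerAr tb.
  case: tpermP => [->|->|/eqP jl /eqP jl'].
  - move/(congr1 ( *%R^~ (b k))): Tl; rewrite mulrBl -!mulrA tb -scalerAr Zk => Tl.
    rewrite scalerBr Tl -addrA -opprD scalerA -scalerDl scalerA; congr (_ - _ *: _); ring.
  - move/(congr1 ( *%R^~ (b k))): Tl'; rewrite mulrDl -!mulrA tb -scalerAr Zk => Tl'.
    rewrite scalerBr Tl' -addrA scalerA -scalerBl scalerA -scaleNr; congr (_ + _ *: _); ring.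
  - rewrite [t j * _]mulrA -Tt //; last by rewrite -l'l.
    by rewrite -mulrA tb -scalerAr scalerBr !scalerA mulrC.
have gb i k : (i.+1 < n)%N -> g i * b k = b (swapk i k) * g i.
  move=> lti; pose l := Ordinal (ltnW lti); pose l' := Ordinal lti.
  by apply: (weight_intertwine bM b1 tb (l := l) (l' := l')) => // j; exact: (gt l l' j).
(* Obtained before the braid relation, since [shift_braid] takes it as a hypothesis. *)
have gquad i : (i.+1 < n)%N -> g i ^+ 2 = 1 + (q - q^-1) *: (e_gen b i * g i).
  move=> lti; apply/eqP; rewrite -subr_eq0 -(shift_quadratic bM b1 gb TE lti).
  by rewrite -hecke_quadratic Tquad.
refine (conj _ (conj _ (conj gquad (conj bM (conj gb b1))))).
- move=> i j lti ltj far; apply/eqP; rewrite -subr_eq0.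
  rewrite -(@shift_far _ _ _ _ _ bM b1 _ _ _ gb TE
            (Ordinal (ltnW lti)) (Ordinal lti) (Ordinal (ltnW ltj)) (Ordinal ltj)) //=.
  by rewrite Tfar // subrr.
- move=> i lti; apply/eqP; rewrite -subr_eq0.
  pose l2 := Ordinal lti; pose l1 := Ordinal (ltnW lti : (i.+1 < n)%N).
  pose l0 := Ordinal (ltnW (ltnW lti)).
  rewrite -(@shift_braid _ _ _ _ _ bM b1 _ _ _ gb TE l0 l1 l2) //=.
  by rewrite Tbraid // subrr.
Qed.

End Presentations.

(** * Passing back and forth between the [t l] and the idempotents *)

Section Recovery.
Set Implicit Arguments. Unset Strict Implicit.
Variables (R : idomainType) (n r : nat) (u : 'I_r -> R).

(** The spectral decomposition of [t i], with colours as eigenvalues; the value 0 at positions out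
    of range only makes the function total. *)
Definition colour_t (S : algType R) (b : mindex n r -> S) (i : nat) : S :=
  \sum_(k : mindex n r) (if insub i is Some l then u (k l) else 0) *: b k.

Lemma colour_t_weight (S : algType R) (b : mindex n r -> S) (l : 'I_n) k :
  (forall k k', b k * b k' = if k == k' then b k else 0) ->
  colour_t b l * b k = u (k l) *: b k.
Proof.
move=> bM; rewrite /colour_t; under eq_bigr do rewrite valK.
exact: (scaled_sum_weight bM (fun k => u (k l)) (weight_idem bM k)).
Qed.

(** On weight [c] the factor at [l] acts as the Kronecker delta of [k l] and [c l]; the product over
    [l] is the delta of [k] and [c]. *)
Lemma bk_recover (S : algType R) (t : nat -> S) (b : mindex n r -> S) k :
  (forall c c', c != c' -> u c - u c' \is a GRing.unit) ->
  (forall k k', b k * b k' = if k == k' then b k else 0) -> \sum_k b k = 1 ->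
  (forall (l : 'I_n) k, t l * b k = u (k l) *: b k) -> bk u t k = b k.
Proof.
move=> uU bM b1 tb; apply: (weight_ext b1) => c; rewrite bk_lagrange bM.
have -> : (\prod_(l < n) horner_alg (t l) (lagrange u (k l))) * b c =
    (\prod_(l < n) (k l == c l)%:R) *: b c.
  elim/big_rec2: _ => [|l y x _ IHl]; first by rewrite mul1r scale1r.
  by rewrite -mulrA IHl -scalerAr (horner_weight tb) lagrange_value // scalerA mulrC.
have [->|/eqP kc] := eqVneq k c.
  by rewrite big1 ?scale1r // => l _; rewrite eqxx.
have [l /negPf kl] : exists l, k l != c l.
  apply/existsP; apply: contra_notT kc => /existsPn kc; apply/ffunP => l.
  by have := kc l; rewrite negbK => /eqP.
by rewrite (bigD1 l) //= kl mul0r scale0r.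
Qed.

Lemma lrmorph_bk (S S' : algType R) (f : {lrmorphism S -> S'}) (t : nat -> S)
    (t' : nat -> S') (k : mindex n r) :
  (forall i, (i < n)%N -> f (t i) = t' i) -> f (bk u t k) = bk u t' k.
Proof.
move=> ft; rewrite rmorph_prod; apply: eq_bigr => l _.
rewrite rmorph_prod; apply: eq_bigr => m _.
by rewrite [LHS]linearZ /= rmorphB /= rmorph_alg ft.
Qed.

End Recovery.

(** * The two mutually inverse homomorphisms *)

Theorem theorem3p13 (R : idomainType) (n r : nat) (q : R) (u : 'I_r -> R)
  (F : 'I_r -> {poly R}) :
  (0 < n)%N -> (0 < r)%N ->
  q \is a GRing.unit -> Delta u \is a GRing.unit ->
  (forall c, (size (F c) <= r)%N) ->
  (forall c c', (F c).[u c'] = (if c == c' then Delta u else 0)) ->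
  forall (H : algType R) (t T : nat -> H), is_shoji_algebra n q u F t T ->
  forall (A : algType R) (g : nat -> A) (b : mindex n r -> A), is_gb_algebra q g b ->
  exists f : {lrmorphism A -> H},
    bijective f /\
    (forall i, (i.+1 < n)%N -> f (g i) = T i + Bp n q u t i i.+1) /\
    (forall k, f (b k) = bk u t k).
Proof.
move=> _ _ qU uD _ FE H t T [Hrel Hex Huniq] A g b [Arel Aex Auniq].
have uU := Delta_unit_sub uD.
have [_ [_ [_ [bM [_ b1]]]]] := Arel.
have tb (l : 'I_n) k := @colour_t_weight R n r u A b l k bM.
pose T' i := g i + (q - q^-1) *: \sum_(k : mindex n r | klt k i i.+1) b k.
(* Each universal property is applied to the generators built inside the other algebra. *)
have [f [fg fb]] := Aex H _ _ (gb_of_shoji qU uD FE Hrel).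
have [h [ht hT]] := Hex A _ T' (shoji_of_gb qU uD FE Arel tb (fun i _ => erefl)).
have hb k : h (bk u t k) = b k.
  by rewrite (lrmorph_bk _ _ ht) (bk_recover _ uU bM b1 tb).
exists f; split; last by split.
exists h => x.
(* Uniqueness reduces the claim to generators, where the two shifts by idempotent sums cancel. *)
- apply: (Auniq A (h \o f) idfun) => [i lti|k] /=; last by rewrite fb hb.
  rewrite fg // rmorphD /= hT // /Bp [h (- _)]rmorphN /= [h (_ *: _)]linearZ /= linear_sum /=.
  by under eq_bigr do rewrite hb; rewrite addrK.
- have [_ [tcol [_ [_ [tC _]]]]] := Hrel.
  have tbk (l : 'I_n) k : t l * bk u t k = u (k l) *: bk u t k.
    by apply: t_bk => // [i j|i]; [apply: tC | apply: tcol].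
  have bk1 : \sum_(k : mindex n r) bk u t k = 1.
    by apply: bk_sum => // i; apply: tcol.
  apply: (Huniq H (f \o h) idfun) => [i lti|i lti] /=.
    rewrite ht // /colour_t linear_sum /= insubT.
    (* Resolving the identity writes [t i] as the sum of its eigenvalues times the idempotents,
       which is the image of [colour_t b i] under [f]. *)
    rewrite -[t i]mulr1 -bk1 mulr_sumr; apply: eq_bigr => k _.
    by rewrite linearZ /= fb (tbk (Ordinal lti)).
  rewrite hT // rmorphD /= fg // linearZ /= linear_sum /= /Bp.
  by under eq_bigr do rewrite fb; rewrite addrNK.
Qed.
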